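(* Let $K\subset\mathbb{R}^n$ be a body, and let $\mathcal{E}\subset K$ be an ellipsoid such that for any ellipsoid $\mathcal{F}\subset K$, $$M_{\mathcal{E}}(\mathcal{F})\ge 1.$$ Then $\mathcal{E}$ is the Löwner-John ellipsoid of $K$.
   Context: A body in $\mathbb{R}^n$ is a compact convex set $K$ with $K=-K$ and non-empty interior; $\|x\|_K=\inf\{\lambda>0: x\in\lambda K\}$ is the norm with unit ball $K$. An ellipsoid means a centrally-symmetric (centered at the origin), non-degenerate ellipsoid. The Löwner-John ellipsoid of $K$ is the (unique) ellipsoid of maximal volume contained in $K$. For an ellipsoid $\mathcal{E}$, $\langle\cdot,\cdot\rangle_{\mathcal{E}}$ is the unique scalar product on $\mathbb{R}^n$ with $\mathcal{E}=\{x:\langle x,x\rangle_{\mathcal{E}}\le 1\}$, and $\mu_{\mathcal{E}}$ is the unique Borel probability measure on $\partial\mathcal{E}$ invariant under all linear isometries of $(\mathbb{R}^n,\langle\cdot,\cdot\rangle_{\mathcal{E}})$. For a body $K$ (in particular an ellipsoid), $M_{\mathcal{E}}(K)=\left(\int_{\partial\mathcal{E}}\|x\|_K^2\,d\mu_{\mathcal{E}}(x)\right)^{1/2}$. *)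

(* Defs.v *)
From HB Require Import structures.
From mathcomp Require Import all_boot all_order all_algebra.
From mathcomp Require Import all_classical all_reals all_analysis.

Set Implicit Arguments.
Unset Strict Implicit.
Unset Printing Implicit Defensive.

Import Order.TTheory GRing.Theory Num.Theory.
Import numFieldNormedType.Exports.

Local Open Scope classical_set_scope.
Local Open Scope ring_scope.

Section Bodies.
Context (R : realType) (n : nat).
Implicit Types (K E F : set 'rV[R]_n).

Definition body K : Prop :=
  [/\ compact K, convex_set K, K = -%R @` K & interior K !=set0].

Definition body_norm K (x : 'rV[R]_n) : R :=
  inf [set l : R | 0 < l /\ ( *:%R l @` K) x].

(* [{dot _ for idfun}] is the type of positive definite symmetric bilinear
   forms, i.e. of scalar products on R^n. *)
Definition unit_ball (q : {dot 'rV[R]_n for idfun}) : set 'rV[R]_n :=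
  [set x | q x x <= 1].

Definition ellipsoid E : Prop :=
  exists q : {dot 'rV[R]_n for idfun}, E = unit_ball q.

Definition box (a b : 'rV[R]_n) : set 'rV[R]_n :=
  [set x | forall i, a 0 i <= x 0 i <= b 0 i].

Definition box_volume (a b : 'rV[R]_n) : R :=
  \prod_(i < n) Num.max 0 (b 0 i - a 0 i).

(* n-dimensional Lebesgue outer measure, which is the Lebesgue measure on
   Lebesgue measurable sets. For n = 0 every box has volume 1, so the values
   are not meaningful there. *)
Definition volume (A : set 'rV[R]_n) : \bar R :=
  ereal_inf [set s | exists a b : nat -> 'rV[R]_n,
    A `<=` \bigcup_k box (a k) (b k) /\
    s = (\sum_(0 <= k <oo) (box_volume (a k) (b k))%:E)%E].

Definition max_volume_ellipsoid K E : Prop :=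
  [/\ ellipsoid E, E `<=` K &
      forall F, ellipsoid F -> F `<=` K -> (volume F <= volume E)%E].

Definition lowner_john K E : Prop := unique (max_volume_ellipsoid K) E.

Definition boundary (A : set 'rV[R]_n) : set 'rV[R]_n :=
  closure A `\` interior A.

Definition borel_rV := g_sigma_algebraType (@open 'rV[R]_n).

(* A Borel probability measure on the boundary of the unit ball of q is encoded
   as a Borel probability measure on R^n giving mass 1 to that boundary. There
   is exactly one measure satisfying this predicate when n > 0, and none when
   n = 0. *)
Definition invariant_measure (q : {dot 'rV[R]_n for idfun})
    (mu : probability borel_rV R) : Prop :=
  mu (boundary (unit_ball q)) = 1%E /\
  forall f : {linear 'rV[R]_n -> 'rV[R]_n},
    (forall x y, q (f x) (f y) = q x y) ->
    forall A : set borel_rV, measurable A -> mu (f @^-1` A) = mu A.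

(* [\int[mu]_] is here the real-valued Lebesgue integral. *)
Definition M (mu : probability borel_rV R) E K : R :=
  Num.sqrt (\int[mu]_(x in boundary E) (body_norm K x ^+ 2)).

End Bodies.

(* Main.v *)
(* Write E = {x : |x L| <= 1} for a matrix L, where q(x, x) = |x L|^2. Any
   ellipsoid F in K is {y C L^-1 : |y| <= 1} for a matrix C which, up to a
   rotation, is the transpose of a lower triangular matrix with positive
   diagonal. By convexity K contains the ellipsoids
   {y ((1 - t) + t C) L^-1 : |y| <= 1}, whose quadratic mean norm over the
   boundary of E is the Hilbert-Schmidt norm of ((1 - t) + t C)^-1 divided by
   sqrt n. The hypothesis at first order in t gives tr C <= n, and likewise
   tr (U C) <= n for every rotation U, since U C describes the same F. Hence
   det C <= 1 by the AM-GM inequality; in the equality case the diagonal of C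
   is 1, and the rotations U by small angles force C = 1. So every F other than
   E has volume |det C| vol E < vol E. *)
Require Import Defs.
From HB Require Import structures.
From mathcomp Require Import all_boot all_order all_algebra all_fingroup.
From mathcomp Require Import ring lra.
From mathcomp Require Import all_classical all_reals all_analysis.
From mathcomp Require Import measurable_realfun.
Import Order.TTheory GRing.Theory Num.Theory.
Import numFieldNormedType.Exports.
Local Open Scope classical_set_scope.
Local Open Scope ring_scope.

Set Implicit Arguments.
Unset Strict Implicit.
Unset Printing Implicit Defensive.

(** * Matrices *)

Section GeneralLinear.
Variable F : fieldType.

(** An invertible matrix has a nonzero entry in its first column, and a transposition of rows moves
    it to the corner. *)
Lemma unitmx_ind_pivot n (Q : 'M[F]_n.+1 -> Prop) :
  (forall A B, Q A -> Q B -> Q (A *m B)) ->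
  (forall s, Q (perm_mx s)) ->
  (forall A : 'M[F]_n.+1, A ord0 ord0 != 0 -> A \in unitmx -> Q A) ->
  forall A, A \in unitmx -> Q A.
Proof.
move=> QM Qp Q0 A Au.
have [i Ai0] : exists i, A i ord0 != 0.
  apply/existsP; apply: contraLR Au => /existsPn A0.
  rewrite unitmxE (expand_det_col A ord0) big1 ?unitr0// => i _.
  by have /negPn/eqP -> := A0 i; rewrite mul0r.
have -> : A = tperm_mx i ord0 *m (tperm_mx i ord0 *m A).
  by rewrite mulmxA -perm_mxM tperm2 perm_mx1 mul1mx.
apply: (QM _ _ (Qp _)); apply: Q0.
  by rewrite -xrowE !mxE tpermR.
by rewrite unitmx_mul Au unitmx_perm.
Qed.

(** Gaussian elimination: clearing the first row and column around the pivot leaves the Schur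
    complement, to which the induction applies. *)
Lemma unitmx_ind n (Q : 'M[F]_n -> Prop) :
  (forall A B, Q A -> Q B -> Q (A *m B)) ->
  (forall d : 'rV_n, (forall i, d 0 i != 0) -> Q (diag_mx d)) ->
  (forall s, Q (perm_mx s)) ->
  (forall i j a, i != j -> Q (1%:M + a *: delta_mx i j)) ->
  forall A, A \in unitmx -> Q A.
Proof.
elim: n Q => [|n IHn] Q QM Qd Qp Qt.
  by move=> A _; rewrite [A]flatmx0 -[0](flatmx0 (perm_mx 1)).
apply: unitmx_ind_pivot => // A; rewrite -[n.+1]/(1 + n)%N in A Q QM Qd Qp Qt *.
move=> A00 Au.
have Q1 : Q 1%:M by rewrite -perm_mx1.
(* Bordering by 1 keeps each kind of generator, so the induction on the size applies. *)
have Qlift B : B \in unitmx -> Q (block_mx 1%:M 0 0 B).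
  move: B; apply: IHn.
  - move=> B C QB QC.
    have -> : block_mx 1%:M 0 0 (B *m C) =
        block_mx 1%:M 0 0 B *m block_mx 1%:M 0 0 C :> 'M[F]_(1 + n).
      by rewrite mulmx_block !mulmx0 !mul0mx !mulmx1 !addr0 !add0r.
    exact: QM.
  - move=> d d0.
    have -> : block_mx 1%:M 0 0 (diag_mx d) = diag_mx (row_mx 1%:M d).
      rewrite diag_mx_row; congr block_mx.
      by apply/matrixP => i j; rewrite !mxE !ord1.
    apply: Qd => i; case: (splitP i) => j ij.
      have -> : i = lshift n j by apply/val_inj.
      by rewrite row_mxEl !ord1 mxE oner_eq0.
    have -> : i = rshift 1 j by apply/val_inj.
    by rewrite row_mxEr.
  - by move=> s; rewrite -[block_mx _ _ _ _]/(lift0_mx _) lift0_mx_perm.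
  - move=> i j a ij.
    have -> : block_mx 1%:M 0 0 (1%:M + a *: delta_mx i j) =
        1%:M + a *: delta_mx (rshift 1 i) (rshift 1 j) :> 'M[F]_(1 + n).
      have -> : delta_mx (rshift 1 i) (rshift 1 j) =
          block_mx 0 0 0 (delta_mx i j) :> 'M[F]_(1 + n).
        apply/matrixP => k l; rewrite -[k]splitK -[l]splitK.
        case: (fintype.split k) => k'; case: (fintype.split l) => l' /=;
          by rewrite ?(block_mxEul, block_mxEur, block_mxEdl, block_mxEdr) !mxE
            ?(eq_lrshift, eq_rlshift, eq_rshift) ?andbF.
      by rewrite (scale_block_mx a) (scalar_mx_block 1 n 1) add_block_mx
        !scaler0 !addr0 .
    by apply: Qt; rewrite eq_rshift.
(* Multiplying such matrices adds their columns [v], so each is a product of transvections. *)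
have Qcol (v : 'cV[F]_n) : Q (block_mx 1%:M 0 v 1%:M).
  have -> : v = \sum_i v i 0 *: delta_mx i 0.
    by rewrite {1}[v]matrix_sum_delta; apply: eq_bigr => i _; rewrite big_ord1.
  apply: (big_ind (fun w => Q (block_mx 1%:M 0 w 1%:M))).
  - by rewrite -scalar_mx_block.
  - move=> w z Qw Qz; have := QM _ _ Qw Qz.
    by rewrite mulmx_block !mulmx0 !mul0mx !mulmx1 !addr0 !mul1mx !add0r.
  - move=> i _; set B := block_mx _ _ _ _.
    have -> : B = 1%:M + v i 0 *: delta_mx (rshift 1 i) (lshift n 0).
      apply/matrixP => k l; rewrite /B -[k]splitK -[l]splitK.
      case: (fintype.split k) => k'; case: (fintype.split l) => l' /=;
        by rewrite ?(block_mxEul, block_mxEur, block_mxEdl, block_mxEdr) !mxE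
          ?(eq_lrshift, eq_rlshift, eq_rshift, eq_lshift)
          ?andbF ?mulr0 ?addr0 ?add0r ?ord1.
    by apply: Qt; rewrite eq_rlshift.
have Qrow (v : 'rV[F]_n) : Q (block_mx 1%:M v 0 1%:M).
  have -> : v = \sum_i v 0 i *: delta_mx 0 i.
    by rewrite {1}[v]matrix_sum_delta big_ord1.
  apply: (big_ind (fun w => Q (block_mx 1%:M w 0 1%:M))).
  - by rewrite -scalar_mx_block.
  - move=> w z Qw Qz; have := QM _ _ Qz Qw.
    by rewrite mulmx_block !mulmx0 !mul0mx !mulmx1 !addr0 !mul1mx !add0r.
  - move=> i _; set B := block_mx _ _ _ _.
    have -> : B = 1%:M + v 0 i *: delta_mx (lshift n 0) (rshift 1 i).
      apply/matrixP => k l; rewrite /B -[k]splitK -[l]splitK.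
      case: (fintype.split k) => k'; case: (fintype.split l) => l' /=;
        by rewrite ?(block_mxEul, block_mxEur, block_mxEdl, block_mxEdr) !mxE
          ?(eq_lrshift, eq_rlshift, eq_rshift, eq_lshift)
          ?andbF ?mulr0 ?addr0 ?add0r ?ord1.
    by apply: Qt; rewrite eq_lrshift.
pose a := A ord0 ord0; pose r := ursubmx A; pose c := dlsubmx A.
pose D := drsubmx A - a^-1 *: (c *m r).
have ulA : ulsubmx A = a%:M.
  apply/matrixP => i j; rewrite !mxE !ord1 /= mulr1n /a.
  by congr (A _ _); apply/val_inj.
have AE : A = block_mx 1%:M 0 (a^-1 *: c) 1%:M *m
              (block_mx a%:M 0 0 1%:M *m block_mx 1%:M 0 0 D *m
               block_mx 1%:M (a^-1 *: r) 0 1%:M).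
  rewrite !mulmx_block !mulmx0 !mul0mx !mulmx1 !mul1mx !addr0 !add0r.
  rewrite -!scalemxAl -!scalemxAr ?mul_scalar_mx ?mul_mx_scalar.
  have aK m k (X : 'M[F]_(m, k)) : a^-1 *: (a *: X) = X.
    by rewrite scalerA mulVf// scale1r.
  by rewrite mul0mx scaler0 add0r -scalemxAr !aK addrC subrK -ulA submxK.
have Du : D \in unitmx.
  move: Au; rewrite AE !unitmx_mul => /andP[_ /andP[/andP[_ +] _]].
  by rewrite unitmxE det_lblock det1 mul1r.
rewrite AE; apply: (QM _ _ (Qcol _)); apply: (QM _ _ _ (Qrow _)).
apply: (QM _ _ _ (Qlift _ Du)).
have -> : block_mx a%:M 0 0 1%:M = diag_mx (row_mx a%:M (const_mx 1)) :> 'M[F]_(1 + n).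
  rewrite diag_mx_row diag_const_mx; congr block_mx.
  by apply/matrixP => i j; rewrite !mxE !ord1.
apply: Qd => i; case: (splitP i) => j ij.
  have -> : i = lshift n j by apply/val_inj.
  by rewrite row_mxEl !ord1 mxE.
have -> : i = rshift 1 j by apply/val_inj.
by rewrite row_mxEr mxE oner_eq0.
Qed.

End GeneralLinear.

(** * The Hilbert-Schmidt norm, and rotations that raise a trace *)

Section HilbertSchmidt.
Variable R : realFieldType.

(** The squared Hilbert-Schmidt norm, which for a row vector is the squared Euclidean length. *)
Definition hs m n (A : 'M[R]_(m, n)) : R := \tr (A *m A^T).

Lemma hsE m n (A : 'M[R]_(m, n)) : hs A = \sum_i \sum_j A i j ^+ 2.
Proof.
apply: eq_bigr => i _; rewrite mxE; apply: eq_bigr => j _.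
by rewrite mxE expr2.
Qed.

Lemma hs_row m n (A : 'M[R]_(m, n)) : hs A = \sum_i hs (row i A).
Proof.
rewrite hsE; apply: eq_bigr => i _; rewrite hsE big_ord1.
by apply: eq_bigr => j _; rewrite mxE.
Qed.

Lemma hs_ge0 m n (A : 'M[R]_(m, n)) : 0 <= hs A.
Proof. by rewrite hsE; do 2 apply: sumr_ge0 => ? _; rewrite sqr_ge0. Qed.

Lemma hs_eq0 m n (A : 'M[R]_(m, n)) : hs A = 0 -> A = 0.
Proof.
rewrite hsE => /eqP; rewrite psumr_eq0 => [/allP A0|i _]; last first.
  by apply: sumr_ge0 => j _; rewrite sqr_ge0.
apply/matrixP => i j; have := A0 i; rewrite mem_index_enum => /(_ isT).
rewrite psumr_eq0 => [/allP/(_ j)|k _]; last by rewrite sqr_ge0.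
by rewrite mem_index_enum mxE => /(_ isT); rewrite sqrf_eq0 => /eqP.
Qed.

Lemma hs_mulmx_orthogonal m n (A : 'M[R]_(m, n)) (U : 'M[R]_n) :
  U *m U^T = 1%:M -> hs (A *m U) = hs A.
Proof. by move=> UU; rewrite /hs trmx_mul mulmxA -(mulmxA A) UU mulmx1. Qed.

Lemma sqr_coord_le_hs m n (A : 'M[R]_(m, n)) i j : A i j ^+ 2 <= hs A.
Proof.
rewrite hsE (bigD1 i)//= (bigD1 j)//= -addrA lerDl addr_ge0//.
  by apply: sumr_ge0 => k _; rewrite sqr_ge0.
by do 2 apply: sumr_ge0 => ? _; rewrite sqr_ge0.
Qed.

Lemma trig_mx_eq1 n (C : 'M[R]_n) : is_trig_mx C -> (forall i, C i i = 1) ->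
  (forall U : 'M[R]_n, U *m U^T = 1%:M -> \tr (U *m C) <= n%:R) -> C = 1%:M.
Proof.
move=> /is_trig_mxP Ct C1 trC; apply/matrixP => i j.
have [->|ij] := eqVneq i j; first by rewrite mxE eqxx C1.
rewrite mxE (negbTE ij); case: (ltngtP i j) => [/Ct//|ji|/val_inj eij]; last first.
  by rewrite eij eqxx in ij.
apply/eqP; case: eqVneq => // c0; set c := C i j in c0.
(* The rotation of the (i, j)-plane with half-angle tangent c / 4 increases
   the trace of C to first order in c. *)
pose u := c / 4; pose a := (1 - u ^+ 2) / (1 + u ^+ 2).
pose s := 2 * u / (1 + u ^+ 2).
have u0 : 1 + u ^+ 2 != 0 by rewrite lt0r_neq0// ltr_pwDl// sqr_ge0.
(* This is a^2 + s^2 = 1, in the form in which it enters the product of [U] and its transpose. *)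
have as1 : 2 * (a - 1) + (a - 1) ^+ 2 + s ^+ 2 = 0 by rewrite /a /s; field.
(* [D] projects onto the (i, j)-plane and [J] is its quarter turn, so [U] is a rotation of that
   plane. *)
pose D : 'M[R]_n := delta_mx i i + delta_mx j j.
pose J : 'M[R]_n := delta_mx j i - delta_mx i j.
pose U := 1%:M + (a - 1) *: D + s *: J.
have ji0 : (j == i) = false by rewrite eq_sym (negbTE ij).
have DD : D *m D = D.
  rewrite mulmxDl !mulmxDr !mul_delta_mx_cond !eqxx (negbTE ij) ji0.
  by rewrite !mulr0n !mulr1n addr0 add0r.
have JJ : J *m J = - D.
  rewrite mulmxBl !mulmxBr !mul_delta_mx_cond !eqxx (negbTE ij) ji0.
  by rewrite !mulr0n !mulr1n subr0 sub0r opprD addrC.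
have DJ : D *m J = J.
  rewrite mulmxDl !mulmxBr !mul_delta_mx_cond !eqxx (negbTE ij) ji0.
  by rewrite !mulr0n !mulr1n subr0 sub0r addrC.
have JD : J *m D = J.
  rewrite mulmxBl !mulmxDr !mul_delta_mx_cond !eqxx (negbTE ij) ji0.
  by rewrite !mulr0n !mulr1n addr0 add0r.
have UT : U^T = 1%:M + (a - 1) *: D - s *: J.
  rewrite /U !linearD/= !linearZ/= trmx1 linearN/= !trmx_delta opprK.
  by congr (_ + _); exact: addrC.
have UU : U *m U^T = 1%:M.
  rewrite UT /U mulmxBr !mulmxDl !mulmxDr !mul1mx !mulmx1.
  rewrite -!scalemxAl -!scalemxAr DD JJ DJ JD.
  clearbody a s D J; apply/matrixP => k l; rewrite !mxE.
  by rewrite -[RHS]addr0 -(mul0r (D k l)) -as1; ring.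
have := trC _ UU; rewrite /U !mulmxDl mul1mx -!scalemxAl !linearD/= !linearZ/=.
have trd (k l : 'I_n) : \tr (delta_mx k l *m C) = C l k.
  rewrite /mxtrace (bigD1 k)//= big1 => [|p pk].
    rewrite addr0 mxE (bigD1 l)//= big1 => [|q ql]; last first.
      by rewrite mxE (negbTE ql) andbF mul0r.
    by rewrite addr0 mxE !eqxx mul1r.
  by rewrite mxE big1// => q _; rewrite mxE (negbTE pk) mul0r.
have trC1 : \tr C = n%:R.
  by rewrite /mxtrace (eq_bigr _ (fun i _ => C1 i)) sumr_const card_ord.
rewrite /D /J !mulmxDl mulNmx !linearD/= linearN/= !trd !C1 trC1.
rewrite (Ct _ _ ji) subr0 -/c -addrA gerDl.
(* With u = c / 4 the loss 2 (1 - a) on the diagonal is half of the gain s c. *)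
have -> : (a - 1) * (1 + 1) + s * c = (c ^+ 2 / 4) / (1 + u ^+ 2).
  by rewrite /a /s /u; field; rewrite /u in u0 *; lra.
by rewrite leNgt divr_gt0// ?ltr_pwDl ?sqr_ge0// mulr_gt0// ?exprn_even_gt0//.
Qed.

End HilbertSchmidt.

(** * Cholesky factorization *)

Section Cholesky.
Variable R : rcfType.

(** Eliminating the first row and column leaves a Schur complement [D] that is again symmetric and
    positive definite. *)
Lemma cholesky n (Q : 'M[R]_n) : Q^T = Q ->
    (forall x : 'rV_n, x != 0 -> 0 < (x *m Q *m x^T) 0 0) ->
  exists2 L : 'M[R]_n, is_trig_mx L /\ (forall i, 0 < L i i) & Q = L *m L^T.
Proof.
elim: n Q => [|n IHn] Q Qs Qpos.
  exists 0; last by rewrite [Q]flatmx0 [RHS]flatmx0.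
  by split=> [|[]//]; apply/is_trig_mxP => -[].
rewrite -[n.+1]/(1 + n)%N in Q Qs Qpos *.
pose a := Q ord0 ord0; pose c := dlsubmx Q; pose D := drsubmx Q - a^-1 *: (c *m c^T).
have QE : Q = block_mx a%:M c^T c (drsubmx Q).
  rewrite -{1}[Q]submxK; congr block_mx.
    apply/matrixP => i j; rewrite !mxE !ord1 /= mulr1n /a.
    by congr (Q _ _); apply/val_inj.
  by rewrite /c trmx_dlsub Qs.
have a_gt0 : 0 < a.
  have /Qpos : delta_mx 0 ord0 != 0 :> 'rV[R]_(1 + n).
    by apply/eqP => /matrixP/(_ 0 ord0)/eqP; rewrite !mxE oner_eq0.
  by rewrite -rowE trmx_delta -colE !mxE.
have aK : a^-1 * a = 1 by rewrite mulVf// gt_eqF.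
have Ds : D^T = D.
  rewrite /D linearB/= linearZ/= trmx_mul trmxK; congr (_ - _).
  by rewrite trmx_drsub Qs.
have Dpos (x : 'rV_n) : x != 0 -> 0 < (x *m D *m x^T) 0 0.
  (* The first coordinate cancels the first entry of y Q, so that the form of [Q] at [y] is the form
     of [D] at [x]. *)
  move=> x0; pose y : 'rV[R]_(1 + n) := row_mx (- a^-1 *: (x *m c)) x.
  have /Qpos : y != 0.
    by apply: contra x0 => /eqP; rewrite -row_mx0 => /eq_row_mx[_ ->].
  rewrite {1}QE /y mul_row_block tr_row_mx mul_row_col.
  rewrite mul_mx_scalar scalerA mulrN (mulrC a) aK scaleN1r addNr mul0mx add0r.
  suff -> : - a^-1 *: (x *m c) *m c^T + x *m drsubmx Q = x *m D by [].
  by rewrite /D mulmxBr -scalemxAr -scalemxAl scaleNr mulmxA addrC.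
have [L [Lt L0] DE] := IHn _ Ds Dpos.
pose r := Num.sqrt a.
have r_gt0 : 0 < r by rewrite sqrtr_gt0.
have rr : r * r = a by rewrite -expr2 sqr_sqrtr// ltW.
exists (block_mx r%:M 0 (r^-1 *: c) L : 'M[R]_(1 + n)).
  split.
    rewrite is_trig_block_mx// eqxx Lt andbT/=.
    by apply/is_trig_mxP => i j; rewrite !ord1.
  move=> i; case: (splitP i) => j ij.
    have -> : i = lshift n j by apply/val_inj.
    by rewrite block_mxEul !ord1 mxE eqxx mulr1n.
  have -> : i = rshift 1 j by apply/val_inj.
  by rewrite block_mxEdr.
rewrite {1}QE tr_block_mx mulmx_block tr_scalar_mx trmx0 !mul0mx !mulmx0 !addr0.
rewrite -scalar_mxM rr linearZ/= mul_scalar_mx mul_mx_scalar !scalerA divff ?gt_eqF//.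
rewrite !scale1r; congr block_mx.
rewrite -scalemxAl -scalemxAr scalerA -invfM rr -DE /D.
by rewrite addrC subrK.
Qed.

End Cholesky.

(** * The trace bound from a first-order variation *)

Section Trace.
Variable R : realType.

Lemma normr_entry_le m n (A : 'M[R]_(m, n)) i j : `|A i j| <= `|A|.
Proof.
rewrite [leRHS]/Num.norm/= mx_normrE; exact: (le_bigmax _ _ (i, j)).
Qed.

Lemma norm_mx_le m n (A : 'M[R]_(m, n)) a :
  0 <= a -> (forall i j, `|A i j| <= a) -> `|A| <= a.
Proof.
move=> a0 Aa; rewrite [leLHS]/Num.norm/= mx_normrE.
by apply: bigmax_le => // -[i j] _; exact: Aa.
Qed.

(** The norm is the maximum of the absolute values of the entries, hence the factor [n] for the
    inner dimension. *)
Lemma norm_mulmx m n p (A : 'M[R]_(m, n)) (B : 'M[R]_(n, p)) :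
  `|A *m B| <= n%:R * (`|A| * `|B|).
Proof.
apply: norm_mx_le => [|i j]; first by rewrite !mulr_ge0.
rewrite mxE (le_trans (ler_norm_sum _ _ _))//.
rewrite (@le_trans _ _ (\sum_(k < n) `|A| * `|B|))//.
  by apply: ler_sum => k _; rewrite normrM ler_pM ?normr_entry_le.
by rewrite sumr_const card_ord mulr_natl.
Qed.

Lemma norm_trace n (A : 'M[R]_n) : `|\tr A| <= n%:R * `|A|.
Proof.
rewrite (le_trans (ler_norm_sum _ _ _))//.
rewrite (@le_trans _ _ (\sum_(k < n) `|A|))//.
  by apply: ler_sum => k _; rewrite normr_entry_le.
by rewrite sumr_const card_ord mulr_natl.
Qed.

(** With X = C - 1, [G] is the inverse of 1 + t X and hs G = n - 2 t tr X + O(t^2). If tr X were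
    positive, this would fall below n for small t. *)
Lemma trace_le n (C : 'M[R]_n) :
  (forall t, 0 < t <= 1 -> forall G, (1 - t) *: G + t *: (G *m C) = 1%:M ->
     n%:R <= hs G) ->
  \tr C <= n%:R.
Proof.
move=> hC; rewrite leNgt; apply/negP => ltC.
pose N : R := n%:R; pose X := C - 1%:M; pose tau := \tr X; pose x := `|X|.
have N0 : 0 <= N by [].
have x0 : 0 <= x by exact: normr_ge0.
have tau_gt0 : 0 < tau by rewrite /tau linearB/= mxtrace1 subr_gt0.
(* [K] bounds the coefficient of t^2: its first term comes from 2 t tr (H X), its second from
   [hs H]. *)
pose K := 4 * N ^+ 3 * x ^+ 2 + 4 * N ^+ 4 * x ^+ 2.
have [t /andP[t0 t1] [tb tK]] : exists2 t : R, 0 < t <= 1 &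
    t * (2 * N * x) <= 1 /\ t * K < tau.
  have NX0 : 0 <= N * x by rewrite mulr_ge0.
  have K0 : 0 <= K by rewrite /K addr_ge0// !mulr_ge0 ?exprn_ge0.
  have b0 : 0 < 1 + 2 * N * x + K / tau.
    by rewrite -addrA ltr_pwDl// addr_ge0 ?divr_ge0 ?mulr_ge0// ltW.
  (* The summands 2 N x and K / tau secure one smallness condition each. *)
  exists (1 + 2 * N * x + K / tau)^-1.
    rewrite invr_gt0 b0/= invf_le1// -addrA lerDl.
    by rewrite addr_ge0 ?divr_ge0 ?mulr_ge0// ltW.
  split; rewrite mulrC.
    rewrite ler_pdivrMr// mul1r [1 + _]addrC -addrA lerDl.
    by rewrite addr_ge0 ?divr_ge0// ltW.
  rewrite ltr_pdivrMr// mulrDr [tau * (K / tau)]mulrCA divff ?gt_eqF// mulr1.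
  by rewrite ltrDr mulr_gt0// ltr_pwDl// -mulrA mulr_ge0.
have IXE (m : nat) (G : 'M[R]_(m, n)) :
    (1 - t) *: G + t *: (G *m C) = G *m (1%:M + t *: X).
  rewrite /X mulmxDr mulmx1 scalerBr mulmxBr -!scalemxAr mulmx1.
  by rewrite scalerBl scale1r addrAC addrA.
have tx : N * (t * x) <= 1 / 2.
  by rewrite mulrCA ler_pdivlMr//; move: tb; rewrite -(mulrA 2) => ?; lra.
have tX0 : `|t *: X| = t * x by rewrite normrZ gtr0_norm.
(* A vector [v] in the left kernel would satisfy |v| <= |v| / 2. *)
have Du : (1%:M + t *: X) \in unitmx.
  rewrite -row_free_unit; apply: inj_row_free => v.
  rewrite mulmxDr mulmx1 => /eqP; rewrite addr_eq0 => /eqP vE.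
  have : `|v| <= `|v| / 2.
    rewrite {1}vE normrN (le_trans (norm_mulmx _ _))// tX0 -/N mulrCA.
    by rewrite ler_wpM2l//; lra.
  have := normr_ge0 v => v0 v2.
  by apply/eqP; rewrite -normr_eq0; apply/eqP; lra.
pose G := invmx (1%:M + t *: X).
have GD : G *m (1%:M + t *: X) = 1%:M by rewrite mulVmx.
have := hC t _ G; rewrite t0 t1 IXE => /(_ isT GD).
pose H := G - 1%:M.
have GE : G = 1%:M + H by rewrite /H addrC subrK.
have HE : H = - (G *m (t *: X)).
  by apply/eqP; rewrite /H subr_eq addrC -GD mulmxDr mulmx1 addrK.
clearbody H G.
(* H = - (1 + H) t X gives |H| <= N t x (1 + |H|), and N t x <= 1/2 allows solving for |H|. *)
have normH : `|H| <= 2 * (N * (t * x)).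
  have H0 : 0 <= `|H| by exact: normr_ge0.
  have norm1 : `|1%:M : 'M[R]_n| <= 1.
    apply: norm_mx_le => // i j; rewrite mxE.
    by case: (i == j); rewrite ?normr1 ?normr0.
  have : `|H| <= N * (t * x) * (1 + `|H|).
    rewrite {1}HE normrN (le_trans (norm_mulmx _ _))// tX0 -/N.
    rewrite mulrCA mulrC ler_wpM2l ?mulr_ge0 ?(ltW t0)// GE.
    by rewrite (le_trans (ler_normD _ _))// lerD2r.
  rewrite mulrDr mulr1; have := ler_wpM2r H0 tx; lra.
have hsG : hs G = N + 2 * \tr H + hs H.
  rewrite /hs GE linearD/= trmx1 mulmxDl !mulmxDr !mul1mx mulmx1.
  by rewrite !linearD/= mxtrace1 mxtrace_tr -/N; ring.
have trH : \tr H = - t * tau - t * \tr (H *m X).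
  rewrite {1}HE GE mulmxDl mul1mx -scalemxAr linearN/= mxtraceD.
  by rewrite (mxtraceZ t X) (mxtraceZ t (H *m X)) -/tau; ring.
have trHX : `|\tr (H *m X)| <= N * (N * (2 * (N * (t * x)) * x)).
  rewrite (le_trans (norm_trace _))// ler_wpM2l//.
  by rewrite (le_trans (norm_mulmx _ _))// ler_wpM2l// ler_wpM2r.
have hsH : hs H <= N * (N * (2 * (N * (t * x))) ^+ 2).
  rewrite hsE (@le_trans _ _ (\sum_(i < n) \sum_(j < n) (2 * (N * (t * x))) ^+ 2))//.
    apply: ler_sum => i _; apply: ler_sum => j _.
    rewrite -real_normK ?num_real// ler_pXn2r// ?nnegrE//.
    exact: le_trans (normr_entry_le _ _ _) normH.
    by rewrite !mulr_ge0 ?(ltW t0).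
  by rewrite !sumr_const !card_ord -[leLHS]mulr_natl -[X in n%:R * X]mulr_natl.
rewrite hsG trH -/N.
have {}trHX : - \tr (H *m X) <= N * (N * (2 * (N * (t * x)) * x)).
  by rewrite (le_trans _ trHX)// -normrN ler_norm.
(* n <= hs G requires this quantity to be at least 2 t tau, but t K < tau makes it less than t
   tau. *)
have {trHX hsH} : 2 * (t * - \tr (H *m X)) + hs H <= t * (t * K).
  have -> : t * (t * K) = 2 * (t * (N * (N * (2 * (N * (t * x)) * x)))) +
      N * (N * (2 * (N * (t * x))) ^+ 2) by rewrite /K; ring.
  by rewrite lerD// ler_pM2l// ler_pM2l.
have : t * (t * K) < t * tau by rewrite ltr_pM2l.
have := mulr_gt0 t0 tau_gt0.
move: (t * (t * K)) (\tr (H *m X)) (hs H) => k y h; clearbody tau N; clear.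
by move=> *; lra.
Qed.

End Trace.

(** * Determinants of triangular matrices under the trace bound *)

Section TriangularMaxDet.
Variable R : realType.

Lemma det_trig_lt1 n (C : 'M[R]_n) : is_trig_mx C -> (forall i, 0 < C i i) ->
    (forall U : 'M[R]_n, U *m U^T = 1%:M -> \tr (U *m C) <= n%:R) ->
  C != 1%:M -> \det C < 1.
Proof.
move=> Ct C0 trC C1; have := trC 1%:M; rewrite trmx1 !mul1mx => /(_ erefl) trC1.
have [] := @leif_AGM _ 'I_n predT (fun i => C i i) (fun i _ => ltW (C0 i)).
rewrite (eq_bigl xpredT)// -(det_trig Ct) cardT size_enum_ord.
set m := _ / _ => AGM AGMeq.
have m0 : 0 <= m by rewrite divr_ge0// sumr_ge0// => i _; exact/ltW.
have m1 : m ^+ n <= 1.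
  rewrite exprn_ile1// /m (eq_bigl xpredT)//.
  (* For n = 0 the mean [m] is a division by zero, hence 0. *)
  have [n0|n0] := posnP n; first by rewrite [X in X%:R]n0 invr0 mulr0.
  by rewrite ler_pdivrMr ?ltr0n// mul1r.
rewrite lt_neqAle (le_trans AGM m1) andbT.
apply: contra C1 => /eqP detC1.
(* Equality in AM-GM makes the diagonal constant; its product is 1, so its entries are 1. *)
have : [forall i in predT, forall j in predT, C i i == C j j].
  by rewrite -AGMeq eq_le AGM detC1 m1.
move=> /forall_inP Ceq; apply/eqP/trig_mx_eq1 => // i.
have Cii j : C j j = C i i by apply/eqP; exact: (forall_inP (Ceq j _)).
have prodC := det_trig Ct; rewrite detC1 in prodC.
move: prodC; rewrite (eq_bigr _ (fun j _ => Cii j)) prodr_const card_ord => /esym/eqP.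
by rewrite pexpr_eq1 ?(ltW (C0 i))// ?(leq_ltn_trans _ (ltn_ord i))// => /eqP.
Qed.

End TriangularMaxDet.

(** * Volume *)

Section OuterMeasure.
Variables (R : realType) (n : nat).
Implicit Types (A B : set 'rV[R]_n) (a b : 'rV[R]_n).
Local Open Scope ereal_scope.

Lemma box_volume_ge0 a b : (0 <= box_volume a b)%R.
Proof. by apply: prodr_ge0 => i _; rewrite le_max lexx. Qed.

Lemma box_volume_refl (a : 'rV[R]_n) : (0 < n)%N -> box_volume a a = 0%R.
Proof.
move=> n0; rewrite /box_volume (bigD1 (Ordinal n0))//=.
by rewrite subrr maxxx mul0r.
Qed.

Lemma volume_ge0 A : 0 <= volume A.
Proof.
apply: le_ereal_inf_tmp => _ [a [b [_ ->]]]; apply: nneseries_ge0 => k _ _.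
by rewrite lee_fin box_volume_ge0.
Qed.

Lemma le_volume A B : A `<=` B -> volume A <= volume B.
Proof.
move=> AB; apply: le_ereal_inf_tmp => s [a [b [Bab ->]]].
apply: ereal_inf_lbound; exists a, b; split=> //.
exact: subset_trans AB Bab.
Qed.

(** A bijection between the naturals and their pairs merges the covers, and nonnegative series may
    be rearranged. *)
Lemma volume_le_double_cover A (a b : nat -> nat -> 'rV[R]_n) :
  A `<=` \bigcup_k \bigcup_j box (a k j) (b k j) ->
  volume A <= \sum_(0 <= k <oo) \sum_(0 <= j <oo) (box_volume (a k j) (b k j))%:E.
Proof.
move=> Aab; have /card_esym/ppcard_eqP[f] := card_nat2.
apply: ereal_inf_lbound; exists (fun k => a (f k).1 (f k).2).
exists (fun k => b (f k).1 (f k).2); split.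
  move=> x /Aab[k _ [j _ xab]]; exists (f^-1%FUN (k, j)) => //.
  by rewrite invK ?inE.
have ge0 k j : 0 <= (box_volume (a k j) (b k j))%:E.
  by rewrite lee_fin box_volume_ge0.
rewrite [RHS]nneseries_esumT// nneseries_esumT; last first.
  by move=> k; apply: nneseries_ge0 => j _ _.
under [LHS]eq_esum do rewrite nneseries_esumT//.
have XTT : [set: nat] `*`` (fun=> [set: nat]) = [set: nat * nat].
  by apply/seteqP; split.
rewrite esum_esum// XTT (reindex_esum [set: nat] _ f (fun kj =>
  (box_volume (a kj.1 kj.2) (b kj.1 kj.2))%:E))//.
Qed.

(** The bounds [v k] are finite, so each [A k] has a cover with excess at most e / 2^(k+1); these
    covers are merged. *)
Lemma volume_bigcup_le (A : nat -> set 'rV[R]_n) (v : nat -> R) :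
  (forall k, volume (A k) <= (v k)%:E) ->
  volume (\bigcup_k A k) <= \sum_(0 <= k <oo) (v k)%:E.
Proof.
move=> Av; have v0 k : 0 <= (v k)%:E := le_trans (volume_ge0 (A k)) (Av k).
apply/lee_addgt0Pr => e e0.
apply: le_trans (epsilon_trick _ v0 (ltW e0)).
have /choice[ab abP] k : exists ab : (nat -> 'rV[R]_n) * (nat -> 'rV[R]_n),
    A k `<=` \bigcup_j box (ab.1 j) (ab.2 j) /\
    \sum_(0 <= j <oo) (box_volume (ab.1 j) (ab.2 j))%:E <=
      (v k)%:E + (e / (2 ^ k.+1)%:R)%:E.
  have : volume (A k) < (v k)%:E + (e / (2 ^ k.+1)%:R)%:E.
    by rewrite (le_lt_trans (Av k))// lteDl// lte_fin divr_gt0// ltr0n expn_gt0.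
  by move=> /ereal_inf_lt[_ [a [b [Aab ->]]] /ltW le]; exists (a, b).
apply: (@le_trans _ _ (\sum_(0 <= k <oo) \sum_(0 <= j <oo)
    (box_volume ((ab k).1 j) ((ab k).2 j))%:E)).
  apply: volume_le_double_cover => x [k _ xA].
  by exists k => //; exact: (abP k).1.
apply: lee_nneseries => k _; last exact: (abP k).2.
by move=> _; apply: nneseries_ge0 => j _ _; rewrite lee_fin box_volume_ge0.
Qed.

Lemma volume_le_finite_cover A N (a b : nat -> 'rV[R]_n) : (0 < n)%N ->
  (forall x, A x -> exists2 k, (k < N)%N & box (a k) (b k) x) ->
  volume A <= (\sum_(k < N) box_volume (a k) (b k))%:E.
Proof.
move=> n0 Aab; apply: ereal_inf_lbound.
(* From [N] on the boxes shrink to points, which have volume 0 because n > 0. *)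
pose c k : 'rV[R]_n := if (k < N)%N then b k else a k.
exists a, c; split.
  by move=> x /Aab[k kN xab]; exists k => //; rewrite /c kN.
rewrite (nneseries_split 0 N); last first.
  by move=> k _; rewrite lee_fin box_volume_ge0.
rewrite add0n eseries0 => [|k Nk _]; last first.
  by rewrite /c ltnNge Nk box_volume_refl.
rewrite adde0 big_mkord -sumEFin; apply: eq_bigr => k _.
by rewrite /c ltn_ord.
Qed.

Lemma volume_box_le a b : (0 < n)%N -> volume (box a b) <= (box_volume a b)%:E.
Proof.
move=> n0; rewrite -[box_volume a b](big_ord1 +%R (fun=> box_volume a b)).
by apply: (@volume_le_finite_cover _ 1 (fun=> a) (fun=> b)) => // x; exists 0%N.
Qed.

(** The outer measure is built from covers by boxes, and the images of the boxes cover the image, so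
    an estimate on boxes carries over to all sets. *)
Lemma volume_image_le (f : 'rV[R]_n -> 'rV[R]_n) (c : R) : (0 < c)%R ->
  (forall a b, volume (f @` box a b) <= (c * box_volume a b)%:E) ->
  forall A, volume (f @` A) <= c%:E * volume A.
Proof.
move=> c0 fc A; rewrite -lee_pdivrMl//.
apply: le_ereal_inf_tmp => _ [a [b [Aab ->]]]; rewrite lee_pdivrMl//.
rewrite -nneseriesZl; last by move=> k _; rewrite lee_fin box_volume_ge0.
apply: (@le_trans _ _ (volume (\bigcup_k (f @` box (a k) (b k))))).
  apply: le_volume => _ [x Ax <-].
  by have [k _ xab] := Aab _ Ax; exists k => //; exists x.
under eq_eseriesr do rewrite -EFinM.
exact: volume_bigcup_le.
Qed.

End OuterMeasure.

(** * The outer measure of a box is at least the product of its sides *)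

Section BoxVolumeLowerBound.
Variable R : realType.
Local Open Scope ereal_scope.

Lemma integral_indic_itv (c a b : R) : (0 <= c)%R ->
  \int[lebesgue_measure]_x (c * \1_(`[a, b]%classic) x)%:E =
    (c * Num.max 0 (b - a))%:E.
Proof.
move=> c0; under eq_integral do rewrite EFinM.
rewrite ge0_integralZl//; last first.
  by apply/measurable_EFinP; exact: measurable_indic.
rewrite integral_indic//= setIT lebesgue_measure_itv/= lte_fin.
by case: ltrP => ab; rewrite -?EFinB -EFinM; congr (_ * _)%:E;
  [rewrite max_r// subr_ge0 ltW | rewrite max_l// subr_le0].
Qed.

(* Integrating the pointwise inequality one coordinate at a time reduces to
   one-dimensional Lebesgue measure. *)
Lemma le_prod_itv m (a b : nat -> R) (ak bk : nat -> nat -> R) (c : R) (ck : nat -> R) :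
  (0 <= c)%R -> (forall k, 0 <= ck k)%R ->
  (forall x : nat -> R,
    (c * \prod_(i < m) \1_(`[a i, b i]%classic) (x i))%:E <=
    \sum_(0 <= k <oo) (ck k * \prod_(i < m) \1_(`[ak k i, bk k i]%classic) (x i))%:E) ->
  (c * \prod_(i < m) Num.max 0 (b i - a i))%:E <=
  \sum_(0 <= k <oo) (ck k * \prod_(i < m) Num.max 0 (bk k i - ak k i))%:E.
Proof.
have prod_ge0 p (u v : nat -> R) : (0 <= \prod_(i < p) Num.max 0 (v i - u i))%R.
  by apply: prodr_ge0 => i _; rewrite le_max lexx.
elim: m c ck => [|m IHm] c ck c0 ck0 H.
  have := H (fun=> 0%R); rewrite !big_ord0 => /le_trans; apply.
  by apply: lee_nneseries => k; rewrite !big_ord0// mulr1 lee_fin.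
(* The last coordinate is frozen at [y] and its indicator is absorbed into the weights, so that the
   induction hypothesis treats the others. *)
have {}H (y : R) :
    ((c * \prod_(i < m) Num.max 0 (b i - a i)) * \1_(`[a m, b m]%classic) y)%:E <=
    \sum_(0 <= k <oo) ((ck k * \prod_(i < m) Num.max 0 (bk k i - ak k i)) *
        \1_(`[ak k m, bk k m]%classic) y)%:E.
  rewrite mulrAC; under eq_eseriesr do rewrite mulrAC.
  apply: (IHm _ (fun k => ck k * \1_(`[ak k m, bk k m]%classic) y)%R).
  - by rewrite mulr_ge0.
  - by move=> k; rewrite mulr_ge0.
  move=> x; have := H (fun i => if i == m then y else x i).
  have E (u v : nat -> R) : (\prod_(i < m.+1) \1_(`[u i, v i]%classic)
      (if i == m :> nat then y else x i) =
      \1_(`[u m, v m]%classic) y * \prod_(i < m) \1_(`[u i, v i]%classic) (x i) :> R)%R.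
    rewrite big_ord_recr/= eqxx mulrC; congr *%R; apply: eq_bigr => i _.
    by rewrite ltn_eqF.
  by rewrite E mulrA; under eq_eseriesr do rewrite E mulrA.
rewrite big_ord_recr/= mulrA -integral_indic_itv ?mulr_ge0 ?prod_ge0//.
rewrite (@eq_eseriesr _ _ (fun k => \int[lebesgue_measure]_y
    ((ck k * \prod_(i < m) Num.max 0 (bk k i - ak k i)) *
      \1_(`[ak k m, bk k m]%classic) y)%:E)); last first.
  by move=> k _; rewrite big_ord_recr/= mulrA integral_indic_itv ?mulr_ge0 ?prod_ge0.
(* Monotone convergence exchanges the series and the integral over [y]. *)
rewrite -integral_nneseries//; last 2 first.
- by move=> k; apply/measurable_EFinP; apply: measurable_funM.
- by move=> k y _; rewrite lee_fin !mulr_ge0 ?prod_ge0.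
apply: ge0_le_integral => //.
- by move=> y _; rewrite lee_fin !mulr_ge0 ?prod_ge0.
- by apply/measurable_EFinP; apply: measurable_funM.
- apply: ge0_emeasurable_sum => k.
    by move=> y _ _; rewrite lee_fin !mulr_ge0 ?prod_ge0.
  by move=> _; apply/measurable_EFinP; apply: measurable_funM.
Qed.

(** A cover by boxes is a pointwise inequality between indicators, which [le_prod_itv]
    integrates. *)
Lemma box_volume_le_volume n (a b : 'rV[R]_n) :
  (box_volume a b)%:E <= volume (box a b).
Proof.
apply: le_ereal_inf_tmp => _ [ak [bk [abk ->]]].
(* Vectors are extended by 0 to sequences, the form that [le_prod_itv] takes. *)
pose ext (v : 'rV[R]_n) (i : nat) : R :=
  oapp (v 0%R) 0%R (insub i : option 'I_n).
have extE v (i : 'I_n) : ext v i = v 0%R i by rewrite /ext valK.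
have boxE u v : box_volume u v = (1 * \prod_(i < n) Num.max 0 (ext v i - ext u i))%R.
  by rewrite mul1r; apply: eq_bigr => i _; rewrite !extE.
rewrite boxE; under eq_eseriesr do rewrite boxE.
apply: (@le_prod_itv n (ext a) (ext b) (fun k => ext (ak k))
  (fun k => ext (bk k)) 1 (fun=> 1%R)) => // x.
pose y : 'rV[R]_n := \row_i x i.
have indE u v : (\prod_(i < n) \1_(`[ext u i, ext v i]%classic) (x i) =
    \1_(box u v) y :> R)%R.
  have [uvy|uvy] := pselect (box u v y).
    rewrite indicE mem_set// big1// => i _; rewrite indicE mem_set//=.
    by have := uvy i; rewrite mxE in_itv/= !extE.
  rewrite indicE memNset//; have /existsNP[i yi] := uvy.
  rewrite (bigD1 i)//= indicE memNset ?mul0r//= in_itv/= !extE.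
  by move: yi; rewrite mxE.
rewrite mul1r indE; under eq_eseriesr do rewrite mul1r indE.
have [aby|aby] := pselect (box a b y); last first.
  by rewrite indicE memNset//; apply: nneseries_ge0 => k _ _; rewrite lee_fin.
have [k _ yk] := abk _ aby.
apply: le_trans (nneseries_lim_ge k.+1 _); last by move=> i _ _; rewrite lee_fin.
rewrite big_nat_recr//= [leLHS](_ : _ = (\1_(box (ak k) (bk k)) y)%:E).
  by rewrite leeDr// sume_ge0// => i _; rewrite lee_fin.
by rewrite !indicE !mem_set.
Qed.

End BoxVolumeLowerBound.

(** * Volume under linear maps *)

Section LinearImage.
Variables (R : realType) (n : nat).
Hypothesis n_gt0 : (0 < n)%N.

Lemma max0_pM (d w : R) : (0 <= d -> Num.max 0 (d * w) = d * Num.max 0 w)%R.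
Proof. by move=> d0; rewrite maxr_pMr// mulr0. Qed.

Lemma volume_box_diag (d a b : 'rV[R]_n) :
  (volume ((fun x => x *m diag_mx d) @` box a b) <=
  (`|\det (diag_mx d)| * box_volume a b)%:E)%E.
Proof.
(* A negative factor reverses the interval, so its end points are exchanged. *)
pose a' : 'rV[R]_n := \row_i (d 0 i * (if 0 <= d 0 i then a 0 i else b 0 i))%R.
pose b' : 'rV[R]_n := \row_i (d 0 i * (if 0 <= d 0 i then b 0 i else a 0 i))%R.
have -> : (`|\det (diag_mx d)| * box_volume a b = box_volume a' b')%R.
  rewrite det_diag normr_prod -big_split/=; apply: eq_bigr => i _.
  rewrite !mxE -max0_pM//; congr (Num.max 0 _).
  by have [d0|/ltW d0] := leP 0 (d 0 i); rewrite -mulrBr;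
    [rewrite ger0_norm|rewrite ler0_norm// mulNr -mulrN opprB].
apply: le_trans (volume_box_le a' b' n_gt0); apply: le_volume => _ [x xab <-] i.
rewrite mul_mx_diag !mxE (mulrC (x 0 i)); have /andP[ax xb] := xab i.
by have [d0|/ltW d0] := leP 0 (d 0 i); [rewrite !ler_wpM2l | rewrite !ler_wnM2l].
Qed.

Lemma volume_box_perm (s : {perm 'I_n}) (a b : 'rV[R]_n) :
  (volume ((fun x => x *m perm_mx s) @` box a b) <=
  (`|\det (perm_mx s)| * box_volume a b)%:E)%E.
Proof.
rewrite det_perm normr_sign mul1r.
have permE (x : 'rV[R]_n) i : (x *m perm_mx s) 0 i = x 0 (s^-1%g i).
  by rewrite -[s]invgK -col_permE mxE invgK.
have -> : box_volume a b = box_volume (a *m perm_mx s) (b *m perm_mx s).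
  rewrite /box_volume (reindex_inj (@perm_inj _ s^-1%g)).
  by apply: eq_bigr => i _; rewrite !permE.
apply: le_trans (volume_box_le _ _ n_gt0); apply: le_volume => _ [x xab <-] i.
by rewrite !permE.
Qed.

(* The box is cut into slices of width [h] along coordinate [i]; the image of
   each slice fits in a box only [2 * `|c| * h] wider in coordinate [j]. *)
Lemma volume_box_transvection_slices (i j : 'I_n) (c h : R) (a b : 'rV[R]_n) :
  i != j -> (0 < h)%R ->
  (volume ((fun x => x *m (1%:M + c *: delta_mx i j)) @` box a b) <=
  ((Num.max 0 (b 0 i - a 0 i)%R + h) *
   (Num.max 0 (b 0 j - a 0 j)%R + 2 * `|c| * h) *
   \prod_(k | (k != i) && (k != j)) Num.max 0 (b 0 k - a 0 k)%R)%:E)%E.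
Proof.
move=> ij h0; set wi := Num.max 0 (b 0 i - a 0 i).
set wj := Num.max 0 (b 0 j - a 0 j).
have wi0 : (0 <= wi)%R by rewrite le_max lexx.
have transvE (x : 'rV[R]_n) k : ((x *m (1%:M + c *: delta_mx i j)) 0 k =
    x 0 k + (if k == j then c * x 0 i else 0))%R.
  rewrite mulmxDr mulmx1 -scalemxAr !mxE (bigD1 i)//= big1 => [|l li].
    rewrite addr0 mxE eqxx/=; case: (k == j) => /=; last by rewrite !mulr0.
    by rewrite mulr1.
  by rewrite mxE (negbTE li) mulr0.
(* The successor keeps the index of the slice below [N] even at the right end point. *)
pose N := (Num.truncn (wi / h)).+1.
pose u (k : nat) : R := (a 0 i + k%:R * h)%R.
(* On slice [k] the shift c x_i stays within |c| h of c u_k, and coordinate [j] allows for this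
   error on both sides. *)
pose ak (k : nat) : 'rV[R]_n := \row_l (if l == i then u k else
  if l == j then a 0 j + (c * u k - `|c| * h) else a 0 l)%R.
pose bk (k : nat) : 'rV[R]_n := \row_l (if l == i then u k + h else
  if l == j then b 0 j + (c * u k + `|c| * h) else b 0 l)%R.
apply: (@le_trans _ _ (\sum_(k < N) box_volume (ak k) (bk k))%:E).
  apply: volume_le_finite_cover => // _ [x xab <-].
  have /andP[ax xb] := xab i.
  have xw : (x 0 i - a 0 i <= wi)%R by rewrite le_max lerD2r xb orbT.
  have xa0 : (0 <= (x 0 i - a 0 i) / h)%R by rewrite divr_ge0 ?subr_ge0// ltW.
  pose k := Num.truncn ((x 0 i - a 0 i) / h)%R.
  exists k; first by rewrite ltnS le_truncn// ler_pM2r ?invr_gt0.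
  have /andP[kx xk] := truncn_itv xa0.
  have ux : (u k <= x 0 i)%R by move: kx; rewrite ler_pdivlMr// /u -/k => ?; lra.
  have xu : (x 0 i <= u k + h)%R.
    by move: xk; rewrite ltr_pdivrMr// -natr1 /u -/k => ?; lra.
  move=> l; rewrite transvE !mxE; have [->|li] := eqVneq l i.
    by rewrite (negbTE ij) addr0 ux xu.
  have [->|lj] := eqVneq l j; last by rewrite addr0; exact: xab.
  have /andP[axj xbj] := xab j.
  have : (`|c * x 0 i - c * u k| <= `|c| * h)%R.
    by rewrite -mulrBr normrM ler_wpM2l// ger0_norm ?subr_ge0// lerBlDl.
  by rewrite ler_norml => /andP[? ?]; apply/andP; split; lra.
rewrite lee_fin (@le_trans _ _ (\sum_(k < N) h * ((wj + 2 * `|c| * h) *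
    \prod_(l | (l != i) && (l != j)) Num.max 0 (b 0 l - a 0 l)%R)))%R//.
  apply: ler_sum => k _; rewrite /box_volume (bigD1 i)//= (bigD1 j)/=; last first.
    by rewrite eq_sym.
  rewrite !mxE eqxx addrAC subrr add0r max_r ?(ltW h0)// eqxx.
  rewrite eq_sym (negbTE ij) ler_wpM2l ?(ltW h0)//.
  rewrite [leLHS](_ : _ = Num.max 0 ((b 0 j - a 0 j) + 2 * `|c| * h)%R *
    \prod_(l | (l != i) && (l != j)) Num.max 0 (b 0 l - a 0 l)%R)%R; last first.
    congr (Num.max 0 _ * _)%R; first by ring.
    by apply: eq_bigr => l /andP[li lj]; rewrite !mxE (negbTE li) (negbTE lj).
  apply: ler_wpM2r; first by apply: prodr_ge0 => l _; rewrite le_max lexx.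
  rewrite ge_max addr_ge0 ?le_max ?lexx ?mulr_ge0 ?(ltW h0)//=.
  by rewrite lerD2r le_max lexx orbT.
rewrite sumr_const card_ord -[leLHS]mulr_natl !mulrA; apply: ler_wpM2r.
  by apply: prodr_ge0 => l _; rewrite le_max lexx.
apply: ler_wpM2r; first by rewrite addr_ge0 ?le_max ?lexx ?mulr_ge0 ?(ltW h0).
(* The slices have total width N h <= wi + h. *)
rewrite /N -natr1 mulrDl mul1r lerD2r -ler_pdivlMr//.
by have /andP[] := truncn_itv (divr_ge0 wi0 (ltW h0)).
Qed.

(** For h <= 1 the slice bound exceeds the volume of the box by at most h D, and h can be taken
    arbitrarily small. *)
Lemma volume_box_transvection (i j : 'I_n) (c : R) (a b : 'rV[R]_n) : i != j ->
  (volume ((fun x => x *m (1%:M + c *: delta_mx i j)) @` box a b) <=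
  (box_volume a b)%:E)%E.
Proof.
move=> ij; apply/lee_addgt0Pr => e e0.
set wi := Num.max 0 (b 0 i - a 0 i).
set wj := Num.max 0 (b 0 j - a 0 j).
set p := (\prod_(k | (k != i) && (k != j)) Num.max 0 (b 0 k - a 0 k)%R)%R.
have wi0 : (0 <= wi)%R by rewrite le_max lexx.
have wj0 : (0 <= wj)%R by rewrite le_max lexx.
have p0 : (0 <= p)%R by apply: prodr_ge0 => l _; rewrite le_max lexx.
pose D := ((wi * (2 * `|c|) + wj + 2 * `|c|) * p)%R.
have D0 : (0 <= D)%R by rewrite mulr_ge0// !addr_ge0 ?mulr_ge0.
(* This choice gives both h <= 1 and h D <= e. *)
pose h := (e / (D + e))%R.
have De : (0 < D + e)%R by rewrite ltr_wpDl.
have h0 : (0 < h)%R by rewrite divr_gt0.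
have h1 : (h <= 1)%R by rewrite ler_pdivrMr// mul1r lerDr.
have hD : (h * D <= e)%R.
  by rewrite mulrAC ler_pdivrMr// ler_wpM2l ?(ltW e0)// lerDl ltW.
apply: le_trans (volume_box_transvection_slices c a b ij h0) _.
rewrite -/wi -/wj -/p -EFinD lee_fin.
have -> : box_volume a b = (wi * wj * p)%R.
  by rewrite /box_volume (bigD1 i)//= (bigD1 j) 1?eq_sym//= mulrA.
apply: le_trans (_ : wi * wj * p + h * D <= _)%R; last by rewrite lerD2l.
have hh : (h * (h * (2 * `|c| * p)) <= h * (2 * `|c| * p))%R.
  by rewrite ler_pM2l// ler_piMl// !mulr_ge0.
by rewrite /D; move: hh; lra.
Qed.

(** The estimate is multiplicative in [T], so it is enough to check it on the generators in
    [unitmx_ind]. *)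
Lemma volume_mulmx (T : 'M[R]_n) : T \in unitmx ->
  forall A, (volume ((fun x => x *m T) @` A) <= `|\det T|%:E * volume A)%E.
Proof.
move: T; apply: unitmx_ind.
- move=> T U HT HU A.
  have -> : (fun x : 'rV[R]_n => x *m (T *m U)) @` A =
      (fun x => x *m U) @` ((fun x => x *m T) @` A).
    rewrite image_comp; suff -> : (fun x => x *m (T *m U)) =
      (fun x : 'rV[R]_n => x *m U) \o (fun x => x *m T) by [].
    by apply/funext => x /=; rewrite mulmxA.
  apply: le_trans (HU _) _; rewrite det_mulmx normrM mulrC EFinM -muleA.
  by rewrite lee_wpmul2l.
- move=> d d0; apply: volume_image_le; last exact: volume_box_diag.
  by rewrite normr_gt0 det_diag prodf_seq_neq0; apply/allP => i _; exact: d0.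
- move=> s; apply: volume_image_le; last exact: volume_box_perm.
  by rewrite det_perm normr_sign.
- move=> i j c ij.
  (* A transvection is lower unitriangular, or becomes so by transposition. *)
  have -> : \det (1%:M + c *: delta_mx i j : 'M[R]_n) = 1.
    have det1 (k l : 'I_n) : (l < k)%N -> \det (1%:M + c *: delta_mx k l : 'M[R]_n) = 1.
      move=> lk; have ltF (p q : 'I_n) : (p < q)%N -> (p == q) = false.
        by move=> pq; rewrite -val_eqE; exact: ltn_eqF.
      have kl : (k == l) = false by rewrite eq_sym ltF.
      rewrite det_trig ?big1// => [p _|].
        rewrite !mxE eqxx; have [->|_] := eqVneq p k; last by rewrite mulr0 addr0.
        by rewrite kl mulr0 addr0.
      apply/is_trig_mxP => p q pq; rewrite !mxE ltF// add0r.
      have [pk|_] := eqVneq p k; last by rewrite mulr0.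
      by rewrite pk in pq; rewrite [q == l]eq_sym (ltF _ _ (ltn_trans lk pq)) mulr0.
    have [lt_ij|/det1//|/val_inj eij] := ltngtP i j; last by rewrite eij eqxx in ij.
    by rewrite -det_tr linearD/= linearZ/= trmx1 trmx_delta det1.
  rewrite normr1; apply: volume_image_le => // a b; rewrite mul1r.
  exact: volume_box_transvection.
Qed.

End LinearImage.

(** * Scalar products and moments of the invariant measure *)

Section DotOfMatrix.
Variables (R : realType) (n : nat) (L : 'M[R]_n).
Hypothesis L_unit : L \in unitmx.
Implicit Types x y : 'rV[R]_n.

(* The unused proof argument lets the instances below depend on [L_unit]. *)
Definition mxdot of L \in unitmx := fun x y => (x *m L *m (y *m L)^T) 0 0.
Local Notation f := (mxdot L_unit).

Let mxdotC x y : f x y = f y x.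
Proof. by rewrite /mxdot -[in LHS](trmxK (x *m L)) -trmx_mul mxE. Qed.

Let mxdotBl y : zmod_morphism (f ^~ y).
Proof. by move=> u v; rewrite /mxdot !mulmxBl !mxE. Qed.

Let mxdotBr x : zmod_morphism (f x).
Proof. by move=> u v; rewrite !(mxdotC x) mxdotBl. Qed.

Let mxdotZl y : scalable_for *%R (f ^~ y).
Proof. by move=> a u; rewrite /mxdot -!scalemxAl mxE. Qed.

Let mxdotZr x : scalable_for (idfun \; *%R) (f x).
Proof. by move=> a u; rewrite !(mxdotC x) mxdotZl. Qed.

HB.instance Definition _ := @isBilinear.Build R 'rV[R]_n 'rV[R]_n R
  *%R (idfun \; *%R) f mxdotBl mxdotBr mxdotZl mxdotZr.

Let mxdot_herm x y : f x y = (-1) ^+ false * idfun (f y x).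
Proof. by rewrite expr0 mul1r mxdotC. Qed.

HB.instance Definition _ :=
  @isHermitianSesquilinear.Build R 'rV[R]_n false idfun f mxdot_herm.

Let mxdot_gt0 x : x != 0 -> 0 < f x x.
Proof.
move=> x0; rewrite /mxdot -trace_mx11 -/(hs _) lt_neqAle hs_ge0 andbT eq_sym.
apply: contra x0 => /eqP/hs_eq0 xL0.
by rewrite -(mulmxK L_unit x) xL0 mul0mx.
Qed.

HB.instance Definition _ := @isDotProduct.Build R 'rV[R]_n f mxdot_gt0.

(** Makes the set of [x] with |x L| <= 1 an ellipsoid for every invertible [L]. *)
Lemma unitmx_dot :
  exists q : {dot 'rV[R]_n for idfun}, forall x y, q x y = (x *m L *m (y *m L)^T) 0 0.
Proof. by exists f. Qed.

End DotOfMatrix.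

(** * Matrices and continuity of scalar products *)

Section DotMatrix.
Variables (R : realType) (n : nat).
Implicit Types (q : {dot 'rV[R]_n for idfun}) (x y u v : 'rV[R]_n) (L : 'M[R]_n).

Lemma dotC q x y : q x y = q y x.
Proof. by rewrite hermitian_subproof expr0 mul1r. Qed.

Lemma dotZl q a x y : q (a *: x) y = a * q x y.
Proof. exact: linearZl_LR. Qed.

Lemma dotZr q a x y : q x (a *: y) = a * q x y.
Proof. by rewrite dotC dotZl dotC. Qed.

Lemma dotDl q x y z : q (x + y) z = q x z + q y z.
Proof. exact: linearDl. Qed.

Lemma dotBl q x y z : q (x - y) z = q x z - q y z.
Proof. exact: linearBl. Qed.

Lemma dotBr q x y z : q x (y - z) = q x y - q x z.
Proof. by rewrite dotC dotBl !(dotC _ x). Qed.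

Lemma dot_ge0 q x : 0 <= q x x.
Proof.
have [->|x0] := eqVneq x 0; first by rewrite linear0r.
by rewrite ltW// neq0_dnorm_gt0.
Qed.

(** [L] is the Cholesky factor of the Gram matrix of the standard basis. *)
Lemma dot_cholesky q : exists2 L, is_trig_mx L /\ (forall i, 0 < L i i) &
  forall x y, q x y = (x *m L *m (y *m L)^T) 0 0.
Proof.
pose Q : 'M[R]_n := \matrix_(i, j) q (delta_mx 0 i) (delta_mx 0 j).
have qE x y : q x y = (x *m Q *m y^T) 0 0.
  rewrite {1}(row_sum_delta x) {1}(row_sum_delta y) linear_sumlz mxE.
  under eq_bigr do rewrite linear_sumr.
  rewrite exchange_big/=; apply: eq_bigr => j _.
  rewrite mxE mulr_suml; apply: eq_bigr => i _.
  by rewrite dotZl dotZr !mxE mulrA mulrAC.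
have [||L LP QE] := @cholesky R n Q.
- by apply/matrixP => i j; rewrite !mxE dotC.
- by move=> x x0; rewrite -qE neq0_dnorm_gt0.
by exists L => // x y; rewrite qE QE trmx_mul !mulmxA.
Qed.

Lemma continuous_coord_mulmx m (L : 'M[R]_(n, m)) j :
  continuous (fun x : 'rV[R]_n => (x *m L) 0 j).
Proof.
move=> x; rewrite (_ : (fun y : 'rV[R]_n => (y *m L) 0 j) =
    (fun y => \sum_i y 0 i * L i j)); last by apply/funext => y; rewrite mxE.
apply: (@cvg_big _ _ +%R 0 _ _ _ _ _ _ _ (nbhs_filter x)) => [|i _].
  exact: add_continuous.
by apply: cvgM; [exact: coord_continuous | exact: cvg_cst].
Qed.

Lemma continuous_dot q u : continuous (q ^~ u).
Proof.
have [L _ qE] := dot_cholesky q.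
have -> : q ^~ u = fun x => (x *m (L *m (u *m L)^T)) 0 0.
  by apply/funext => x; rewrite qE mulmxA.
exact: continuous_coord_mulmx.
Qed.

Lemma continuous_dot_norm q : continuous (fun x => q x x).
Proof.
have [L _ qE] := dot_cholesky q.
have -> : (fun x => q x x) = fun x => \sum_i (x *m L) 0 i ^+ 2.
  apply/funext => x; rewrite qE mxE; apply: eq_bigr => i _.
  by rewrite [in X in _ * X]mxE expr2.
move=> x; apply: (@cvg_big _ _ +%R 0 _ _ _ _ _ _ _ (nbhs_filter x)) => [|i _].
  exact: add_continuous.
by apply: cvgM; exact: continuous_coord_mulmx.
Qed.

End DotMatrix.

(** * Unit spheres, norms and reflections *)

Section UnitBall.
Variables (R : realType) (n : nat) (q : {dot 'rV[R]_n for idfun}).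
Implicit Types x y u w : 'rV[R]_n.

Lemma boundary_unit_ball : boundary (unit_ball q) = [set x | q x x = 1].
Proof.
apply/seteqP; split => x /=.
  move=> [clx intx]; apply/eqP; rewrite eq_le; apply/andP; split.
    have cl : closed (unit_ball q).
      rewrite (_ : unit_ball q = (fun x => q x x) @^-1` [set y | y <= 1])//.
      apply: closed_comp; last exact: closed_le.
      by move=> y _; exact: continuous_dot_norm.
    by rewrite closure_id in cl; rewrite -cl in clx.
  rewrite leNgt; apply/negP => qx1; apply: intx.
  rewrite /interior/= nbhsE/=; exists ((fun x => q x x) @^-1` [set y | y < 1]).
    split=> //; apply: open_comp; last exact: open_lt.
    by move=> y _; exact: continuous_dot_norm.
  by move=> y /= /ltW.
move=> qx1; split; first by apply: subset_closure; rewrite /unit_ball/= qx1.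
rewrite /interior/= => intx.
(* If [x] were interior, (1 + e / 2) x would lie in the ball for some e > 0, but [q] takes the value
   (1 + e / 2)^2 > 1 there. *)
have /nbhs_ballP[e /= e0 be] : nbhs (1 : R) ((fun s : R => s *: x) @^-1` unit_ball q).
  have := @scalel_continuous _ _ x 1; apply.
  by rewrite scale1r.
have /be : ball (1 : R) e (1 + e / 2).
  by rewrite /ball/= opprD addrA subrr sub0r normrN gtr0_norm; lra.
rewrite /preimage/unit_ball/= dotZl dotZr qx1 mulr1 leNgt => /negP; apply.
have ee : 0 < e * e by exact: mulr_gt0.
by nra.
Qed.

Lemma body_norm_unit_ball x : body_norm (unit_ball q) x = Num.sqrt (q x x).
Proof.
have imE l : 0 < l -> ( *:%R l @` unit_ball q) x <-> q x x <= l ^+ 2.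
  move=> l0; split.
    move=> [y qy <-]; rewrite dotZl dotZr mulrA -expr2.
    by rewrite ler_piMr// sqr_ge0.
  move=> qxl; exists (l^-1 *: x); last by rewrite scalerA divff ?scale1r// gt_eqF.
  rewrite /unit_ball/= dotZl dotZr mulrA -invfM mulrC ler_pdivrMr ?mulr_gt0//.
  by rewrite mul1r -expr2.
have lb : lbound [set l | 0 < l /\ ( *:%R l @` unit_ball q) x] (Num.sqrt (q x x)).
  move=> l [l0 /(imE _ l0) qxl].
  by rewrite -(ger0_norm (ltW l0)) -sqrtr_sqr ler_wsqrtr.
apply/eqP; rewrite eq_le; apply/andP; split; last first.
  apply: lb_le_inf lb; exists (q x x + 1); have := dot_ge0 q x => qx0.
  have l0 : 0 < q x x + 1 by lra.
  by split=> //; apply/imE => //; nra.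
(* For x = 0 the root is 0 and lies outside the set, so it is approached from above. *)
apply/ler_addgt0Pr => e e0; apply: ge_inf; first by exists (Num.sqrt (q x x)).
have l0 : 0 < Num.sqrt (q x x) + e by rewrite ltr_wpDl// sqrtr_ge0.
split=> //; apply/imE => //; rewrite -{1}(sqr_sqrtr (dot_ge0 q x)).
by rewrite ler_pXn2r ?nnegrE ?sqrtr_ge0 ?(ltW l0)// lerDl ltW.
Qed.

(** These are the isometries to which the invariance of the measure is applied. *)
Definition reflection w x := x - (2 * q x w / q w w) *: w.

Lemma reflection_linear w : linear (reflection w).
Proof.
move=> a x y; rewrite /reflection dotDl dotZl scalerBr scalerA.
rewrite addrACA -opprD -scalerDl; by congr (_ - _ *: _); ring.
Qed.

HB.instance Definition _ w :=
  GRing.isLinear.Build R 'rV[R]_n 'rV[R]_n *:%R (reflection w) (reflection_linear w).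

Lemma reflection_continuous w : continuous (reflection w).
Proof.
have -> : reflection w = fun x => x - q x ((2 / q w w) *: w) *: w.
  by apply/funext => x; rewrite /reflection dotZr mulrAC.
move=> x; apply: (@cvgB _ _ _ _ (nbhs_filter x)); first exact: cvg_id.
apply: (@cvgZ _ _ _ _ (nbhs_filter x)); first exact: continuous_dot.
exact: (@cvg_cst _ _ _ _ (nbhs_filter x)).
Qed.

Lemma reflection_isometry w x y : w != 0 ->
  q (reflection w x) (reflection w y) = q x y.
Proof.
move=> w0; have qw : q w w != 0 by rewrite gt_eqF// neq0_dnorm_gt0.
rewrite /reflection !dotBl !dotBr !dotZl !dotZr (dotC q w y).
by field.
Qed.

(** The reflection along u - v is self-adjoint and exchanges the vectors [u] and [v] of equal
    length. *)
Lemma dot_reflection_sub u v x : q u u = q v v -> u != v ->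
  q (reflection (u - v) x) u = q x v.
Proof.
move=> uv; rewrite -subr_eq0 => w0.
have qw : q (u - v) (u - v) != 0 by rewrite gt_eqF// neq0_dnorm_gt0.
have qwE : q (u - v) (u - v) = 2 * q (u - v) u.
  by rewrite !dotBl !dotBr (dotC q v u) -uv; ring.
have -> : reflection (u - v) x = x - (q x (u - v) / q (u - v) u) *: (u - v).
  by rewrite /reflection qwE -mulf_div divff ?pnatr_eq0// mul1r.
rewrite dotBl dotZl divfK; first by rewrite dotBr; ring.
by rewrite qwE mulf_eq0 negb_or in qw; case/andP: qw.
Qed.

End UnitBall.

(** * Second moments of the invariant measure *)

Section Moments.
Variables (R : realType) (n : nat) (q : {dot 'rV[R]_n for idfun}).
Variable mu : probability (borel_rV R n) R.
Hypothesis hmu : invariant_measure q mu.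
Implicit Types x y u w : 'rV[R]_n.
Local Notation S := (boundary (unit_ball q)).

Lemma borel_continuous_map (f : 'rV[R]_n -> 'rV[R]_n) : continuous f ->
  measurable_fun [set: borel_rV R n] (f : borel_rV R n -> borel_rV R n).
Proof.
move=> /continuousP cf.
apply: (@measurability _ _ (borel_rV R n) (borel_rV R n) _ _ (@open 'rV[R]_n)) => //.
by move=> _ [A oA <-]; rewrite setTI; apply: sub_sigma_algebra; exact: cf.
Qed.

Lemma borel_continuous (f : 'rV[R]_n -> R) : continuous f ->
  measurable_fun [set: borel_rV R n] (f : borel_rV R n -> R).
Proof.
move=> /continuousP cf; apply: (measurability _ (RGenOpens.measurableE R)).
move=> _ [_ [a [b ->] <-]]; rewrite setTI; apply: sub_sigma_algebra; apply: cf.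
exact: interval_open.
Qed.

Lemma measurable_boundary_unit_ball : measurable (S : set (borel_rV R n)).
Proof.
rewrite boundary_unit_ball -[X in measurable X]setTI.
exact: (borel_continuous (@continuous_dot_norm _ _ q) measurableT (measurable_set1 1)).
Qed.

(** The value is an extended real; its finiteness comes out in [momentE]. *)
Definition moment u : \bar R := (\int[mu]_(x in S) ((q x u) ^+ 2)%:E)%E.

Lemma measurable_dot_sqr u :
  measurable_fun (S : set (borel_rV R n)) (fun x : borel_rV R n => ((q x u) ^+ 2)%:E).
Proof.
apply/measurable_EFinP; apply: measurable_funX.
by apply: measurable_funTS; apply: borel_continuous; exact: continuous_dot.
Qed.

Lemma moment_ge0 u : (0 <= moment u)%E.
Proof. by apply: integral_ge0 => x _; rewrite lee_fin sqr_ge0. Qed.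

Lemma momentZ a u : moment (a *: u) = ((a ^+ 2)%:E * moment u)%E.
Proof.
rewrite /moment -ge0_integralZl ?lee_fin ?sqr_ge0//.
- by apply: eq_integral => x _; rewrite dotZr exprMn EFinM.
- exact: measurable_boundary_unit_ball.
- exact: measurable_dot_sqr.
- by move=> x _; rewrite lee_fin sqr_ge0.
Qed.

(** The reflection exchanging [u] and [v] preserves the measure and the sphere, so a change of
    variables identifies the integrals. *)
Lemma moment_eq u v : q u u = q v v -> moment u = moment v.
Proof.
have [-> //|uv] := eqVneq u v; move=> quv.
pose f : {linear 'rV[R]_n -> 'rV[R]_n} := reflection q (u - v).
have f_isom x y : q (f x) (f y) = q x y.
  by apply: reflection_isometry; rewrite subr_eq0.
pose g : borel_rV R n -> borel_rV R n := f.
have gm : measurable_fun setT g :=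
  borel_continuous_map (@reflection_continuous _ _ q (u - v)).
have muf (A : set (borel_rV R n)) : measurable A -> A `<=` S ->
    mu A = pushforward mu g A.
  by move=> mA _; rewrite -(hmu.2 f f_isom).
rewrite {1}/moment (eq_measure_integral (pushforward mu g))//.
rewrite (ge0_integral_pushforward gm)//; last 3 first.
  - exact: measurable_boundary_unit_ball.
  - exact: measurable_dot_sqr.
  - by move=> x _; rewrite lee_fin sqr_ge0.
rewrite (_ : g @^-1` S = S); last first.
  by rewrite boundary_unit_ball; apply/seteqP; split => x /=; rewrite f_isom.
apply: eq_integral => x _ /=.
by rewrite dot_reflection_sub.
Qed.

End Moments.

(** * The quadratic mean norm of an ellipsoid *)

Section MeanNorm.
Variables (R : realType) (n : nat) (q : {dot 'rV[R]_n for idfun}).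
Variable mu : probability (borel_rV R n) R.
Hypothesis hmu : invariant_measure q mu.
Variable L : 'M[R]_n.
Hypothesis L_unit : L \in unitmx.
Hypothesis qE : forall x y, q x y = (x *m L *m (y *m L)^T) 0 0.
Local Notation S := (boundary (unit_ball q)).

Lemma dot_hs x : q x x = hs (x *m L).
Proof. by rewrite qE -trace_mx11. Qed.

(** The rows of [invmx L] form an orthonormal basis for [q], in which [x] has the coordinates x
    L. *)
Lemma dot_coord x i : q x (delta_mx 0 i *m invmx L) = (x *m L) 0 i.
Proof. by rewrite qE mulmxKV// trmx_delta -colE mxE. Qed.

Lemma dot_sum_sqr x : q x x = \sum_i q x (delta_mx 0 i *m invmx L) ^+ 2.
Proof.
rewrite dot_hs hsE big_ord1; apply: eq_bigr => i _.
by rewrite dot_coord.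
Qed.

Lemma integral_sum_sqr_dot (I : finType) (g : I -> 'rV[R]_n) :
  (\int[mu]_(x in S) (\sum_i q x (g i) ^+ 2)%:E = \sum_i moment q mu (g i))%E.
Proof.
under eq_integral do rewrite -sumEFin.
rewrite ge0_integral_sum//.
- exact: measurable_boundary_unit_ball.
- by move=> i; exact: measurable_dot_sqr.
- by move=> i x _; rewrite lee_fin sqr_ge0.
Qed.

(** In dimension 0 the sphere is empty and cannot carry mass 1. *)
Lemma dim_gt0 : (0 < n)%N.
Proof.
rewrite lt0n; apply/eqP => n0; have := hmu.1; rewrite boundary_unit_ball.
suff -> : [set x | q x x = 1] = set0.
  by rewrite measure0 => /eqP; rewrite eq_sym onee_eq0.
apply/seteqP; split=> // x /=; rewrite dot_sum_sqr big1 => [/eqP|i _].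
  by rewrite eq_sym oner_eq0.
by have := ltn_ord i; rewrite [X in (_ < X)%N]n0.
Qed.

(** The moments of an orthonormal basis are equal and sum to the mass 1 of the sphere, so each is 1
    / n; [u] has the length of a multiple of a basis vector. *)
Lemma momentE u : moment q mu u = (q u u / n%:R)%:E.
Proof.
have n0 := dim_gt0; have nR0 : n%:R != 0 :> R by rewrite pnatr_eq0 -lt0n.
pose e i : 'rV[R]_n := delta_mx 0 i *m invmx L.
have ee i : q (e i) (e i) = 1.
  by rewrite dot_coord /e mulmxKV// mxE !eqxx.
have sum1 : (\sum_i moment q mu (e i) = 1)%E.
  rewrite -integral_sum_sqr_dot -[RHS]hmu.1 -[RHS]mul1e -integral_cst.
    apply: eq_integral => x; rewrite inE boundary_unit_ball => qx1.
    by rewrite -dot_sum_sqr qx1.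
  exact: measurable_boundary_unit_ball.
pose i0 := Ordinal n0.
have me : moment q mu (e i0) = (n%:R^-1)%:E.
  (* Being at most 1, the moment is finite, and the equation for the sum can be solved in the
     reals. *)
  have : (moment q mu (e i0) <= 1)%E.
    by rewrite -sum1 (bigD1 i0)//= leeDl// sume_ge0// => i _; exact: moment_ge0.
  move: sum1; rewrite (eq_bigr (fun=> moment q mu (e i0))); last first.
    by move=> i _; apply: moment_eq => //; rewrite !ee.
  have := moment_ge0 q mu (e i0).
  case: (moment q mu (e i0)) => [r _|_ _|//]; last by rewrite leye_eq.
  rewrite sumEFin sumr_const card_ord => -[rn] _.
  by congr EFin; apply: (mulfI nR0); rewrite mulr_natl rn divff.
rewrite (moment_eq hmu (v := Num.sqrt (q u u) *: e i0)); last first.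
  by rewrite dotZl dotZr ee mulr1 -expr2 sqr_sqrtr// dot_ge0.
by rewrite momentZ sqr_sqrtr ?dot_ge0// me -EFinM.
Qed.

Lemma M_unit_ball (p : {dot 'rV[R]_n for idfun}) (L' : 'M[R]_n) :
  (forall x, p x x = hs (x *m L')) ->
  M mu (unit_ball q) (unit_ball p) = Num.sqrt (hs (invmx L *m L') / n%:R).
Proof.
move=> pE; rewrite /M; congr Num.sqrt.
(* [g i] represents the i-th coordinate of x L' through [q], so the squared norm is a sum of
   integrands of moments. *)
pose g i : 'rV[R]_n := delta_mx 0 i *m (invmx L *m L')^T *m invmx L.
have gE x i : q x (g i) = (x *m L') 0 i.
  rewrite qE /g mulmxKV// trmx_mul trmxK trmx_delta !mulmxA mulmxK//.
  by rewrite -colE mxE.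
rewrite /Rintegral (_ : integral _ _ _ = \sum_i moment q mu (g i))%E; last first.
  rewrite -integral_sum_sqr_dot; apply: eq_integral => x _.
  rewrite body_norm_unit_ball sqr_sqrtr ?dot_ge0// pE hsE big_ord1.
  by congr EFin; apply: eq_bigr => i _; rewrite gE.
under eq_bigr do rewrite momentE.
rewrite sumEFin/= -mulr_suml; congr (_ / _).
have -> : hs (invmx L *m L') = hs (invmx L *m L')^T.
  by rewrite /hs trmxK mxtrace_mulC.
rewrite hs_row; apply: eq_bigr => i _; rewrite dot_hs /g mulmxKV//.
by rewrite rowE.
Qed.

End MeanNorm.

(** * Ellipsoids of maximal volume *)

Section EllipsoidVolume.
Variables (R : realType) (n : nat) (q : {dot 'rV[R]_n for idfun}).
Hypothesis n_gt0 : (0 < n)%N.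

Lemma volume_unit_ball_gt0 : (0 < volume (unit_ball q))%E.
Proof.
have /nbhs_ballP[e /= e0 be] : nbhs (0 : 'rV[R]_n) (unit_ball q).
  rewrite nbhsE/=; exists ((fun x => q x x) @^-1` [set y | y < 1]).
    split; last by rewrite /= linear0r.
    apply: open_comp; last exact: open_lt.
    by move=> y _; exact: continuous_dot_norm.
  by move=> y /= /ltW.
(* Half of the radius keeps the closed cube inside the open ball of the maximum norm. *)
pose a : 'rV[R]_n := const_mx (e / 2).
have ab : box (- a) a `<=` unit_ball q.
  move=> x xa; apply: be; split=> // i j; rewrite ord1 mxE /ball/= sub0r normrN.
  by have := xa j; rewrite !mxE -ler_norml => xj; apply: le_lt_trans xj _; lra.
apply: lt_le_trans (le_volume ab); apply: lt_le_trans (box_volume_le_volume _ _).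
rewrite lte_fin; apply: prodr_gt0 => i _.
by rewrite !mxE lt_max; apply/orP; right; lra.
Qed.

Lemma volume_unit_ball_lty : (volume (unit_ball q) < +oo)%E.
Proof.
have [L [Lt L0] qE] := dot_cholesky q.
have Lu : L \in unitmx.
  by rewrite unitmxE det_trig// unitfE gt_eqF// prodr_gt0.
(* The bound comes from x = (x L) L^-1, where the entries of x L are at most 1 in absolute value. *)
pose a : 'rV[R]_n := const_mx (n%:R * `|invmx L|).
have qa : unit_ball q `<=` box (- a) a.
  move=> x qx i; rewrite !mxE -ler_norml; apply: le_trans (normr_entry_le _ _ _) _.
  rewrite -{1}(mulmxK Lu x) (le_trans (norm_mulmx _ _))// ler_wpM2l//.
  rewrite ler_piMl//; apply: norm_mx_le => // k l.
  rewrite -(ler_pXn2r (n := 2))// ?nnegrE// expr1n real_normK ?num_real//.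
  by rewrite (le_trans (sqr_coord_le_hs _ _ _))// -(dot_hs qE).
apply: le_lt_trans (le_volume qa) _.
exact: le_lt_trans (volume_box_le _ _ n_gt0) (ltry _).
Qed.

End EllipsoidVolume.

(** * Comparison of the given ellipsoid with its competitors in [K] *)

Section Extremal.
Variables (R : realType) (n : nat) (K : set 'rV[R]_n).
Variables (q : {dot 'rV[R]_n for idfun}) (mu : probability (borel_rV R n) R).
Hypothesis K_convex : convex_set K.
Hypothesis qK : unit_ball q `<=` K.
Hypothesis hmu : invariant_measure q mu.
Hypothesis hM : forall F : set 'rV[R]_n,
  ellipsoid F -> F `<=` K -> 1 <= M mu (unit_ball q) F.
Variable L : 'M[R]_n.
Hypothesis L_unit : L \in unitmx.
Hypothesis qE : forall x y, q x y = (x *m L *m (y *m L)^T) 0 0.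

(** The ellipsoid |x L G| <= 1 has quadratic mean norm equal to the square root of hs G / n. *)
Lemma le_hs_of_ellipsoid (G : 'M[R]_n) : G \in unitmx ->
  (forall x, hs (x *m (L *m G)) <= 1 -> K x) -> n%:R <= hs G.
Proof.
move=> Gu GK; have n0 := dim_gt0 hmu L_unit qE.
have [p pE] : exists p : {dot 'rV[R]_n for idfun}, forall x y,
    p x y = (x *m (L *m G) *m (y *m (L *m G))^T) 0 0.
  by apply: unitmx_dot; rewrite unitmx_mul L_unit.
have /hM : ellipsoid (unit_ball p) by exists p.
rewrite (M_unit_ball hmu L_unit qE (dot_hs pE)) mulKmx//.
have pK : unit_ball p `<=` K by move=> x; rewrite /unit_ball/= (dot_hs pE) => /GK.
move=> /(_ pK); rewrite -{1}sqrtr1 ler_psqrt ?nnegrE// ?divr_ge0 ?hs_ge0//.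
by rewrite ler_pdivlMr ?ltr0n// mul1r.
Qed.

(** Convexity puts y D L^-1 into [K] for |y| <= 1, where D = (1 - t) + t C; these points form the
    ellipsoid |x L G| <= 1 with [G] inverse to [D]. *)
Lemma trace_le_dim (C : 'M[R]_n) :
  (forall y : 'rV_n, hs y <= 1 -> K (y *m C *m invmx L)) -> \tr C <= n%:R.
Proof.
move=> CK; apply: trace_le => t /andP[t0 t1] G GD.
pose D := (1 - t)%:M + t *: C.
have {}GD : G *m D = 1%:M by rewrite mulmxDr mul_mx_scalar -scalemxAr.
have [Gu _] := mulmx1_unit GD.
apply: le_hs_of_ellipsoid => // x xG.
set y : 'rV_n := x *m (L *m G) in xG.
have yE : hs (y *m invmx L *m L) <= 1 by rewrite mulmxKV.
have -> : x = t *: (y *m C *m invmx L) + (1 - t) *: (y *m invmx L).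
  transitivity (y *m D *m invmx L).
    by rewrite /y !mulmxA -(mulmxA _ G) GD mulmx1 mulmxK.
  rewrite /D mulmxDr mulmxDl mul_mx_scalar -scalemxAr -!scalemxAl.
  exact: addrC.
have yC : y *m C *m invmx L \in K by rewrite inE; exact: CK.
have yK : y *m invmx L \in K.
  by rewrite inE; apply: qK; rewrite /unit_ball/= (dot_hs qE).
have := K_convex (Itv01 (ltW t0) t1) yC yK; rewrite inE; exact.
Qed.

Lemma volume_ellipsoid_lt (p : {dot 'rV[R]_n for idfun}) :
  unit_ball p `<=` K -> unit_ball p <> unit_ball q ->
  (volume (unit_ball p) < volume (unit_ball q))%E.
Proof.
move=> pK pq; have n0 := dim_gt0 hmu L_unit qE.
have [L' [L't L'0] pE] := dot_cholesky p.
have L'u : L' \in unitmx.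
  by rewrite unitmxE det_trig// unitfE gt_eqF// prodr_gt0.
pose W := invmx L *m L'; have LW : L *m W = L' by rewrite mulKVmx.
(* The ball of [p] consists of the points y W^-1 L^-1 with |y| <= 1. The Cholesky factorization
   below replaces W^-1 by a triangular matrix. *)
have Wu : W \in unitmx by rewrite unitmx_mul unitmx_inv L_unit.
have WE : invmx L *m L' = W by [].
clearbody W; pose N := (invmx W)^T.
have [||B [Bt B0] NB] := @cholesky R n (N *m N^T).
- by rewrite trmx_mul trmxK.
- move=> x x0; rewrite -mulmxA -mulmxA -trmx_mul mulmxA.
  rewrite -trace_mx11 -/(hs _) lt_neqAle hs_ge0 andbT eq_sym.
  apply: contra x0 => /eqP/hs_eq0 xN0.
  have Nu : N \in unitmx by rewrite unitmx_tr unitmx_inv.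
  by rewrite -(mulmxK Nu x) xN0 mul0mx.
have Bu : B \in unitmx.
  by rewrite unitmxE det_trig// unitfE gt_eqF// prodr_gt0.
(* [C] and [invmx W] have the same Gram matrix, so they differ by the rotation
   [U0]; the ball of [p] is the set of [y *m C *m invmx L] with [hs y <= 1]. *)
pose C := B^T; pose U0 := C *m W.
have U0U0 : U0 *m U0^T = 1%:M.
  rewrite /U0 trmx_mul trmxK mulmxA; apply: mulmx1C.
  rewrite !mulmxA -NB /N trmxK mulmxKV//.
  by rewrite -trmx_mul mulmxV// trmx1.
(* The vector y U runs through the Euclidean ball with [y], so U C describes the same ellipsoid as
   [C]. *)
have trU (U : 'M[R]_n) : U *m U^T = 1%:M -> \tr (U *m C) <= n%:R.
  move=> UU; apply: trace_le_dim => y y1; apply: pK.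
  rewrite /unit_ball/= (dot_hs pE) -!mulmxA WE -/U0 mulmxA.
  by rewrite !hs_mulmx_orthogonal.
have hsW x : hs (x *m L *m invmx C) = hs (x *m L').
  rewrite -(hs_mulmx_orthogonal _ U0U0) /U0 mulmxA mulmxKV ?unitmx_tr//.
  by rewrite -mulmxA LW.
have [C1|C1] := eqVneq C 1%:M.
  case: pq; apply/funext => x; rewrite /unit_ball/=.
  by rewrite (dot_hs pE) -hsW C1 invmx1 mulmx1 (dot_hs qE).
(* The determinant bound applies to the lower triangular [B], whose trace condition follows from tr
   (U B) = tr (U^T C). *)
have detC : 0 < \det C < 1.
  rewrite det_tr det_trig// prodr_gt0//= -(det_trig Bt) det_trig_lt1//.
    move=> U UU; rewrite -mxtrace_tr trmx_mul mxtrace_mulC.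
    by apply: trU; rewrite trmxK; exact: mulmx1C.
  by apply: contra C1 => /eqP B1; rewrite /C B1 trmx1.
(* [T] carries the ball of [q] over the ball of [p] and has the determinant of [C]. *)
pose T := L *m C *m invmx L.
have Cu : C \in unitmx by rewrite unitmx_tr.
have Tu : T \in unitmx by rewrite !unitmx_mul L_unit Cu unitmx_inv.
have detT : \det T = \det C.
  by rewrite !det_mulmx det_inv mulrAC divff ?mul1r// -unitfE -unitmxE.
have pT : unit_ball p `<=` (fun x => x *m T) @` unit_ball q.
  move=> x; rewrite /unit_ball/= (dot_hs pE) -hsW => xC.
  exists (x *m L *m invmx C *m invmx L).
    by rewrite (dot_hs qE) mulmxKV.
  by rewrite /T !mulmxA mulmxKV// mulmxKV// mulmxK.
apply: le_lt_trans (le_volume pT) _; apply: le_lt_trans (volume_mulmx n0 Tu _) _.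
have /andP[C0 ltC1] := detC; rewrite detT gtr0_norm//.
(* A positive finite volume strictly decreases under multiplication by det C < 1. *)
have := volume_unit_ball_gt0 q; have := volume_unit_ball_lty q n0.
case: (volume _) => [v _|//|//]; rewrite lte_fin => v0.
by rewrite -EFinM lte_fin gtr_pMl.
Qed.

End Extremal.

Theorem corollary1p2 (R : realType) (n : nat) (K E : set 'rV[R]_n)
    (q : {dot 'rV[R]_n for idfun}) (mu : probability (borel_rV R n) R)
    (hK : body K) (hE : E = unit_ball q) (hEK : E `<=` K)
    (hmu : invariant_measure q mu)
    (hM : forall F : set 'rV[R]_n, ellipsoid F -> F `<=` K -> 1 <= M mu E F) :
  lowner_john K E.
Proof.
subst E; have [_ K_convex _ _] := hK.
have [L [Lt L0] qE] := dot_cholesky q.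
have Lu : L \in unitmx.
  by rewrite unitmxE det_trig// unitfE gt_eqF// prodr_gt0.
(* The strict inequality for every other ellipsoid in [K] gives both maximality and uniqueness. *)
have lt_q := volume_ellipsoid_lt K_convex hEK hmu hM Lu qE.
have Eq : ellipsoid (unit_ball q) by exists q.
split.
  split=> // F [p ->] pK.
  have [-> //|pq] := pselect (unit_ball p = unit_ball q).
  by apply/ltW/lt_q.
move=> F [[p ->] pK maxF]; apply: contrapT => /nesym pq.
by have := lt_q p pK pq; rewrite ltNge maxF.
Qed.
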